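(* Let $p$ be a prime and $N$ a positive integer, and let $J=\{0,1\}^N\subset\mathbb{F}_p^N$. Let $D_{\mathbb{F}_p}(J,N)$ denote the maximum cardinality of a set $H\subset\mathbb{F}_p^N$ such that no two distinct elements $\vec{x},\vec{y}\in H$ satisfy $\vec{x}-\vec{y}\in J$. Then $$D_{\mathbb{F}_p}(J,N)\le\left(1-\frac{1}{2}\left(1-\frac{1}{p-1}\right)^p\right)(p-1)^N.$$
   Context: $\mathbb{F}_p$ is the finite field with $p$ elements, and $\{0,1\}^N$ is viewed as a subset of $\mathbb{F}_p^N$ (vectors all of whose coordinates are $0$ or $1$). *)

(* Defs.v *)
From HB Require Import structures.
From mathcomp Require Import all_boot all_order all_algebra.

Set Implicit Arguments.
Unset Strict Implicit.
Unset Printing Implicit Defensive.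

Import Order.TTheory GRing.Theory Num.Theory.
Local Open Scope ring_scope.

Definition cube01 (F : finFieldType) (N : nat) : {set 'rV[F]_N} :=
  [set v : 'rV[F]_N | [forall i, (v 0 i == 0) || (v 0 i == 1)]].

(* The pair (x, y) is ordered, so for x != y both x - y and y - x must lie
   outside J. *)
Definition avoids_differences (F : finFieldType) (N : nat)
    (J H : {set 'rV[F]_N}) : bool :=
  [forall x in H, forall y in H, (x != y) ==> (x - y \notin J)].

(* The range contains H = set0, so the maximum is attained. *)
Definition maxD (F : finFieldType) (N : nat) (J : {set 'rV[F]_N}) : nat :=
  \max_(H : {set 'rV[F]_N} | avoids_differences J H) #|H|.

(* Main.v *)
(** Let [f z = \prod_i (\delta_0 (z_i) - \delta_1 (z_i))], which is supported on
    [{0,1}^N]. For [h] in a difference-avoiding set [H], both [f (x - h)] and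
    [f (h - x)] restrict to the indicator of [h] on [H], and both have zero sum
    along every axis-parallel line, so they live in a space of dimension
    [(p-1)^N]. If [p] and [N] are odd, these [2|H|] functions are independent:
    a relation yields [v = \sum_h a_h f (x - h)] with [v (x + 1) = - v x], where
    [1] is the all-ones vector, and going [p] times around gives [v = - v].
    Hence [2|H| <= (p-1)^N]. For even [N], slicing along one coordinate gives
    [2|H| <= p (p-1)^(N-1)], which is still below the claimed bound. *)
Require Import Defs.
From HB Require Import structures.
From mathcomp Require Import all_boot all_order all_algebra.
From mathcomp Require Import ring lra.

Set Implicit Arguments.
Unset Strict Implicit.
Unset Printing Implicit Defensive.

Import Order.TTheory GRing.Theory Num.Theory.
Local Open Scope ring_scope.

Lemma avoids_differencesP (F : finFieldType) (N : nat) (J H : {set 'rV[F]_N}) :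
  reflect {in H &, forall x y, x != y -> x - y \notin J}
          (avoids_differences J H).
Proof.
apply: (iffP forall_inP) => [HJ x y xH yH | HJ x xH].
  by move/forall_inP: (HJ x xH) => /(_ y yH) /implyP.
by apply/forall_inP => y yH; apply/implyP; apply: HJ.
Qed.

Definition edge_diff (F : finFieldType) (z : F) : F := (z == 0)%:R - (z == 1)%:R.

Definition cube_diff (F : finFieldType) (N : nat) (z : 'rV[F]_N) : F :=
  \prod_i edge_diff (z 0 i).

Definition row_upd (F : finFieldType) (N : nat) (x : 'rV[F]_N) (i : 'I_N) (c : F) :
  'rV[F]_N := \row_j if j == i then c else x 0 j.

Definition line_sum0 (F : finFieldType) (N : nat) (v : 'rV[F]_N -> F) :=
  forall x i, \sum_c v (row_upd x i c) = 0.

Section CubeDiff.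

Variables (F : finFieldType) (N : nat).
Implicit Types (x z : 'rV[F]_N) (H : {set 'rV[F]_N}) (v : 'rV[F]_N -> F).

Lemma edge_diffN (z : F) : edge_diff (- z) = - edge_diff (z + 1).
Proof.
rewrite /edge_diff opprB oppr_eq0 eqr_oppLR -addr_eq0.
by rewrite -[z + 1 == 1]subr_eq0 addrK.
Qed.

(** Negation followed by a unit shift swaps the two support points of [edge_diff], so each factor
    changes sign and an odd number of signs remains. Thus reflected copies of [cube_diff] are, up to
    sign, translates of it. *)
Lemma cube_diffN z : odd N -> cube_diff (- z) = - cube_diff (z + const_mx 1).
Proof.
move=> oddN; rewrite /cube_diff.
under eq_bigr => i _ do rewrite mxE edge_diffN.
rewrite prodrN card_ord -signr_odd oddN expr1 mulN1r.
by congr (- _); apply: eq_bigr => i _; rewrite !mxE.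
Qed.

Lemma cube_diff0 : cube_diff (0 : 'rV[F]_N) = 1.
Proof.
rewrite /cube_diff big1 // => i _.
by rewrite mxE /edge_diff eqxx eq_sym oner_eq0 subr0.
Qed.

Lemma cube_diff_out z : z \notin cube01 F N -> cube_diff z = 0.
Proof.
rewrite inE negb_forall => /existsP[i]; rewrite negb_or => /andP[z0 z1].
by rewrite /cube_diff (bigD1 i) //= /edge_diff (negPf z0) (negPf z1) subr0 mul0r.
Qed.

Lemma sum_edge_diff : \sum_(c : F) edge_diff c = 0.
Proof.
rewrite sumrB; apply/eqP; rewrite subr_eq0; apply/eqP.
rewrite (bigD1 0) //= [RHS](bigD1 1) //= !eqxx.
by rewrite !big1 // => c /negPf ->.
Qed.

(** Only the [i]-th factor varies along the line, and over the whole line it runs through all values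
    of [edge_diff], whose sum is zero. *)
Lemma line_sum0_cube_diffB h : line_sum0 (fun x => cube_diff (x - h)).
Proof.
move=> x i; rewrite /cube_diff.
under eq_bigr => c _.
  rewrite (bigD1 i) //= !mxE eqxx.
  under eq_bigr => j ji do rewrite !mxE (negPf ji).
  over.
rewrite -mulr_suml -[X in X * _](_ : \sum_(c : F) edge_diff c = _).
  by rewrite sum_edge_diff mul0r.
by rewrite (reindex_inj (addIr (- h 0 i))).
Qed.

Lemma line_sum0_sum (I : finType) (a : I -> F) (w : I -> 'rV[F]_N -> F) :
  (forall k, line_sum0 (w k)) -> line_sum0 (fun x => \sum_k a k * w k x).
Proof.
move=> w0 x i; rewrite exchange_big big1 // => k _.
by rewrite -mulr_sumr w0 mulr0.
Qed.

Lemma line_sum0D v w : line_sum0 v -> line_sum0 w -> line_sum0 (fun x => v x + w x).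
Proof. by move=> v0 w0 x i; rewrite big_split /= v0 w0 addr0. Qed.

Lemma line_sum0_shift v s : line_sum0 v -> line_sum0 (fun x => v (x + s)).
Proof.
move=> v0 x i; rewrite -[RHS](v0 (x + s) i) [RHS](reindex_inj (addIr (s 0 i))).
apply: eq_bigr => c _; congr v; apply/rowP => j; rewrite !mxE.
by case: eqP => // ->.
Qed.

(* Solving the line sum for a coordinate equal to [-1] lowers the number of
   such coordinates. *)
Lemma line_sum0_eq0 v : line_sum0 v ->
  (forall x, (forall i, x 0 i != -1) -> v x = 0) -> forall x, v x = 0.
Proof.
move=> v0 vQ x.
have [n] := ubnP #|[set i | x 0 i == -1]|; elim: n x => // n IHn x ltn.
have [/forallP/vQ //|] := boolP [forall i, x 0 i != -1].
rewrite negb_forall => /existsP[i]; rewrite negbK => /eqP xi.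
have := v0 x i; rewrite (bigD1 (-1)) //= big1 => [|c cN1]; last first.
  apply: IHn; rewrite ltnS in ltn; apply: leq_trans ltn.
  apply/proper_card/properP; split.
    by apply/subsetP => j; rewrite !inE mxE; case: (j == i); rewrite ?(negPf cN1).
  by exists i; rewrite !inE ?xi ?mxE ?eqxx.
rewrite addr0; congr (v _ = 0).
by apply/rowP => j; rewrite mxE; case: eqP => // ->.
Qed.

End CubeDiff.

Section OddDimension.

Variables (p N : nat).
Hypotheses (p_prime : prime p) (p_odd : odd p) (N_odd : odd N).
Let F := 'F_p.

Lemma antiperiodic_eq0 (v : 'rV[F]_N -> F) :
  (forall x, v (x + const_mx 1) = - v x) -> forall x, v x = 0.
Proof.
move=> vN x.
have vn n : v (x + const_mx n%:R) = (-1) ^+ n * v x.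
  elim: n => [|n IHn]; first by rewrite raddf0 addr0 mul1r.
  rewrite -natr1 raddfD /= addrA vN IHn exprS; ring.
have := vn p; rewrite -signr_odd p_odd expr1 mulN1r.
have /andP[_ /eqP ->] := pchar_Fp p_prime.
rewrite raddf0 addr0 => /eqP; rewrite -addr_eq0 -mulr2n -mulr_natl mulf_eq0.
suff /negPf -> : (2%:R : F) != 0 by move/eqP.
rewrite -(dvdn_pcharf (pchar_Fp p_prime)) gtnNdvd //.
by case: (p) p_prime p_odd => [|[|[|]]].
Qed.

Lemma card_avoids_odd (H : {set 'rV[F]_N}) :
  avoids_differences (cube01 F N) H -> (2 * #|H| <= p.-1 ^ N)%N.
Proof.
move=> /avoids_differencesP HJ.
pose T : finType := {h | h \in H}.
(* [Q] encodes the points without coordinate [-1], whose values determine a function with zero line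
   sums. *)
pose Q : finType := {ffun 'I_N -> {c : F | c != -1}}.
pose pt (q : Q) : 'rV[F]_N := \row_i val (q i).
pose one : 'rV[F]_N := const_mx 1.
pose v (a : {ffun T -> F}) (x : 'rV[F]_N) := \sum_h a h * cube_diff (x - val h).
have fH (h g : T) : cube_diff (val g - val h) = (h == g)%:R.
  have [->|hg] := eqVneq h g; first by rewrite subrr cube_diff0.
  by apply: cube_diff_out; apply: HJ; rewrite ?(valP h) ?(valP g) // eq_sym.
have vH a (g : T) : v a (val g) = a g.
  rewrite /v (bigD1 g) //= fH eqxx mulr1 big1 ?addr0 // => h hg.
  by rewrite fH (negPf hg) mulr0.
have v1H a (g : T) : v a (val g + one) = - a g.
  rewrite /v; transitivity (- \sum_h a h * cube_diff (val h - val g)).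
    rewrite -sumrN; apply: eq_bigr => h _.
    by rewrite -[val h - _]opprB cube_diffN // mulrN opprK addrAC.
  rewrite (bigD1 g) //= fH eqxx mulr1 big1 ?addr0 // => h hg.
  by rewrite fH eq_sym (negPf hg) mulr0.
have v0 a : line_sum0 (v a).
  by apply: line_sum0_sum => h; apply: line_sum0_cube_diffB.
(* By [cube_diffN] the second term is minus the combination of the reflected functions
   [cube_diff (h - x)], with coefficients [ab.2]. *)
pose comb (ab : {ffun T -> F} * {ffun T -> F}) x := v ab.1 x + v ab.2 (x + one).
pose Phi ab : {ffun Q -> F} := [ffun q => comb ab (pt q)].
have comb_eq0 ab : (forall q, comb ab (pt q) = 0) -> ab = 0.
  case: ab => a b abQ.
  have ab0 : forall x, comb (a, b) x = 0.
    apply: line_sum0_eq0 => [|x xN1].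
      by apply: line_sum0D (v0 a) _; apply: line_sum0_shift (v0 b).
    rewrite -[RHS](abQ [ffun i => Sub (x 0 i) (xN1 i)]); congr comb.
    by apply/rowP => i; rewrite mxE ffunE.
  (* At a point of [H] the relation reads [a h - b h = 0]; with [b = a] it becomes antiperiodicity
     of [v a]. *)
  have eq_ab : b = a.
    apply/ffunP => h; have /eqP := ab0 (val h).
    by rewrite /comb /= vH v1H subr_eq0 => /eqP.
  suff a0 : a = 0 by rewrite eq_ab a0.
  apply/ffunP => h; rewrite ffunE -vH; apply: antiperiodic_eq0 => x.
  by apply/eqP; rewrite -addr_eq0 addrC; have := ab0 x; rewrite eq_ab => /eqP.
have combB ab cd x : comb (ab - cd) x = comb ab x - comb cd x.
  have vB a b y : v (a - b) y = v a y - v b y.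
    by rewrite -sumrB; apply: eq_bigr => h _; rewrite !ffunE mulrBl.
  by rewrite /comb !vB opprD addrACA.
have Phi_inj : injective Phi.
  move=> ab cd /ffunP eqPhi; apply/eqP; rewrite -subr_eq0; apply/eqP.
  apply: comb_eq0 => q; rewrite combB.
  by have := eqPhi q; rewrite !ffunE => ->; rewrite subrr.
(* Dimensions are compared by counting: injectivity gives [p ^ (2 * #|H|) <= p ^ (p.-1 ^ N)]. *)
have := leq_card Phi Phi_inj.
rewrite card_prod !card_ffun !card_sig (card_ord N) (card_Fp p_prime).
rewrite -expnD addnn -mul2n -[#|[pred x | x != _]|]/#|predC1 (-1 : F)|.
by rewrite cardC1 (card_Fp p_prime) leq_exp2l ?prime_gt1.
Qed.

End OddDimension.

Lemma card_avoids_slice (p M m : nat) (H : {set 'rV['F_p]_M.+1}) :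
  prime p ->
  (forall K : {set 'rV['F_p]_M},
     avoids_differences (cube01 'F_p M) K -> (2 * #|K| <= m)%N) ->
  avoids_differences (cube01 'F_p M.+1) H -> (2 * #|H| <= p * m)%N.
Proof.
move=> p_prime Km /avoids_differencesP HJ.
have -> : #|H| = (\sum_(c : 'F_p) #|[set x in H | (x 0 0 == c)%R]|)%N.
  rewrite -sum1_card (partition_big (fun x : 'rV_M.+1 => x 0 0) xpredT) //=.
  by apply: eq_bigr => c _; rewrite -sum1_card; apply: eq_bigl => x; rewrite inE.
rewrite big_distrr /= -[p in (_ <= p * _)%N]card_Fp // -sum_nat_const.
apply: leq_sum => c _.
set Hc := [set x in H | x 0 0 == c].
(* Within a slice the deleted coordinate of [x - y] is 0, so membership in the cube lifts back. This
   yields both injectivity of the projection and avoidance for its image. *)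
have liftJ (x y : 'rV['F_p]_M.+1) : x \in Hc -> y \in Hc ->
    col' 0 x - col' 0 y \in cube01 'F_p M -> x = y.
  rewrite !inE => /andP[xH /eqP xc] /andP[yH /eqP yc] /forallP xyJ.
  apply/eqP/negPn/negP => /(HJ x y xH yH)/negP; apply.
  rewrite inE; apply/forallP => i; rewrite !mxE.
  have [j|] := unliftP 0 i; last by move=> ->; rewrite xc yc subrr eqxx.
  by move=> ->; have := xyJ j; rewrite !mxE.
have col_inj : {in Hc &, injective (col' 0)}.
  move=> x y xH yH xy; apply: liftJ => //; rewrite xy subrr inE.
  by apply/forallP => i; rewrite mxE eqxx.
rewrite -(card_in_imset col_inj); apply: Km.
apply/avoids_differencesP => _ _ /imsetP[x xH ->] /imsetP[y yH ->].
by apply: contra => /(liftJ x y xH yH) ->.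
Qed.

(** Over ['F_2] the cube is the whole space, so every difference is forbidden. *)
Lemma card_avoids_char2 (N : nat) (H : {set 'rV['F_2]_N}) :
  avoids_differences (cube01 'F_2 N) H -> (#|H| <= 1)%N.
Proof.
move=> /avoids_differencesP HJ; apply/card_le1_eqP => y x yH xH.
apply/eqP/negPn/negP => /(HJ x y xH yH)/negP; apply; rewrite inE.
by apply/forallP => i; case: ((x - y) 0 i) => [[|[|]]].
Qed.

(** The odd-dimensional bound is weakened by [p.-1 <= p] to match the one that slicing gives for
    even [N]. *)
Lemma card_avoids (p N : nat) (H : {set 'rV['F_p]_N}) :
  prime p -> odd p -> (0 < N)%N ->
  avoids_differences (cube01 'F_p N) H -> (2 * #|H| <= p * p.-1 ^ N.-1)%N.
Proof.
move=> p_prime p_odd N_gt0 HJ; have [oddN|] := boolP (odd N).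
  apply: leq_trans (card_avoids_odd p_prime p_odd oddN HJ) _.
  by rewrite -{1}(prednK N_gt0) expnS leq_mul2r leq_pred orbT.
case: N N_gt0 H HJ => // M _ H HJ; rewrite /= negbK => oddM.
exact: (card_avoids_slice p_prime (fun K => @card_avoids_odd p M p_prime p_odd oddM K)).
Qed.

Theorem theorem3 (p N : nat) (p_prime : prime p) (N_gt0 : (0 < N)%N) :
  (maxD (cube01 'F_p N))%:R
    <= (1 - 1 / 2%:R * (1 - 1 / (p%:R - 1)) ^+ p) * (p%:R - 1) ^+ N :> rat.
Proof.
have [p_even|p_odd] := even_prime p_prime.
  (* For [p = 2] the base [1 - 1 / (p - 1)] vanishes and the claimed bound is 1. *)
  subst p; have max1 : (maxD (cube01 'F_2 N) <= 1)%N.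
    by apply/bigmax_leqP => H; apply: card_avoids_char2.
  have -> : 2%:R - 1 = 1 :> rat by [].
  by rewrite divr1 subrr expr0n mulr0 subr0 expr1n mulr1 lern1.
have maxD2 : (2 * maxD (cube01 'F_p N) <= p * p.-1 ^ N.-1)%N.
  rewrite /maxD; elim/big_ind: _ => // [m n m2 n2|H]; first by rewrite maxnMr geq_max m2.
  exact: card_avoids.
have p_gt2 : (2 < p)%N by case: (p) p_prime p_odd => [|[|[|]]].
set q : rat := p%:R - 1.
have q_ge2 : 2 <= q by rewrite lerBrDr -[2]/(2%:R) natr1 ler_nat.
have pow_le : (1 - 1 / q) ^+ p <= 1 - 1 / q.
  have q_inv : 0 <= 1 / q <= 1.
    by rewrite divr_ge0 ?ler_pdivrMr ?mul1r /=; lra.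
  rewrite -[leRHS]expr1; apply: ler_wiXn2l; [lra | lra | exact: prime_gt0].
have qE : p.-1%:R = q by rewrite -subn1 natrB // prime_gt0.
have Y_ge0 : 0 <= q ^+ N.-1 by apply: exprn_ge0; lra.
have {}maxD2 : 2 * (maxD (cube01 'F_p N))%:R <= (q + 1) * q ^+ N.-1.
  by rewrite subrK -qE -natrX -!natrM ler_nat.
have -> : q ^+ N = q * q ^+ N.-1 by rewrite -exprS prednK.
rewrite mulrA.
(* Replacing the exponent [p] by 1 only enlarges the power, and then the right side is exactly
   [(q + 1) / 2], that is [p / 2]. *)
have : (q + 1) / 2 <= (1 - 1 / 2%:R * (1 - 1 / q) ^+ p) * q.
  have -> : (q + 1) / 2 = (1 - 1 / 2%:R * (1 - 1 / q)) * q by field; lra.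
  by apply: ler_wpM2r; lra.
move=> /(ler_wpM2r Y_ge0); lra.
Qed.
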